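(* Let $D$ be a Newton diagram in $2$ variables whose support $K$ is connected and has size $d$. Then $\#(D)\ge\frac{d+5}{2}$.
   Context: For $m\in\mathbb Z^n$ write $|m|=m_1+\dots+m_n$; $e_1,\dots,e_n$ is the standard basis. A Newton diagram in $n$ variables is a function $D\colon\mathbb Z^n\to\{0,P,N\}$ ($P,N$ formal symbols) whose support $K=D^{-1}(\{P,N\})$ is a finite nonempty subset of $\mathbb N_0^n$. For $a\in\mathbb Z^n$ let $E(a)=\{a,a-e_1,\dots,a-e_n\}$; $E(a)$ is a node of $D$ if the image $D(E(a))$ equals $\{P\}$, $\{N\}$, $\{0,P\}$ or $\{0,N\}$. $\#(D)$ is the number of $a\in\mathbb Z^n$ for which $E(a)$ is a node. Two distinct points $m,m'$ are adjacent if $m-m'\in\{\pm e_j\}\cup\{e_j-e_k: j\ne k\}$; $K$ is connected if any two points of $K$ are joined by a path of successively adjacent points of $K$. The size of $K$ is $k-|a|+1$ where $k=\max_{m\in K}|m|$ and $a_j=\min_{m\in K}m_j$. *)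

(* Defs.v *)
From Stdlib Require Import ZArith List.
Open Scope Z_scope.

Inductive sgn : Type := Zr | Ps | Ng.

Definition pt : Type := (Z * Z)%type.

Definition support (D : pt -> sgn) (m : pt) : Prop := D m <> Zr.

Definition newton_diagram2 (D : pt -> sgn) : Prop :=
  (exists l : list pt, forall m, support D m -> In m l) /\
  (forall m, support D m -> 0 <= fst m /\ 0 <= snd m) /\
  (exists m, support D m).

Definition E (a : pt) : list pt :=
  (fst a, snd a) :: (fst a - 1, snd a) :: (fst a, snd a - 1) :: nil.

Definition in_image (D : pt -> sgn) (a : pt) (s : sgn) : Prop :=
  exists x, In x (E a) /\ D x = s.

Definition is_node (D : pt -> sgn) (a : pt) : Prop :=
  let I := in_image D a in
  (I Ps /\ ~ I Zr /\ ~ I Ng) \/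
  (I Ng /\ ~ I Zr /\ ~ I Ps) \/
  (I Zr /\ I Ps /\ ~ I Ng) \/
  (I Zr /\ I Ng /\ ~ I Ps).

Definition num_nodes (D : pt -> sgn) (n : nat) : Prop :=
  exists l : list pt, NoDup l /\ (forall a, In a l <-> is_node D a) /\ length l = n.

Definition adjacent (m m' : pt) : Prop :=
  let u := fst m - fst m' in let v := snd m - snd m' in
  (u = 1 /\ v = 0) \/ (u = -1 /\ v = 0) \/ (u = 0 /\ v = 1) \/ (u = 0 /\ v = -1) \/
  (u = 1 /\ v = -1) \/ (u = -1 /\ v = 1).

Inductive joined (K : pt -> Prop) : pt -> pt -> Prop :=
| joined_refl : forall m, K m -> joined K m m
| joined_step : forall m m' m'', joined K m m' -> adjacent m' m'' -> K m'' ->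
    joined K m m''.

Definition connected (K : pt -> Prop) : Prop :=
  forall m m', K m -> K m' -> joined K m m'.

Definition is_size (K : pt -> Prop) (d : Z) : Prop :=
  exists k a1 a2,
    (exists m, K m /\ fst m + snd m = k) /\ (forall m, K m -> fst m + snd m <= k) /\
    (exists m, K m /\ fst m = a1) /\ (forall m, K m -> a1 <= fst m) /\
    (exists m, K m /\ snd m = a2) /\ (forall m, K m -> a2 <= snd m) /\
    d = k - (a1 + a2) + 1.

(* Main.v *)
Require Import Defs.
From Stdlib Require Import ZArith List Bool Lia.
Open Scope Z_scope.

(** Sweep the rows [snd m = j] of the diagram from the top downwards and let
    [S_j] be the set of columns [i] such that [(i, j)] lies in one of the
    triangles with horizontal base on row [j] and apex a point of the support;
    [S_{j-1}] is the union of [S_j], [S_j + 1] and the row [j-1] of the support.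
    The number [w_j] of nodes [E(a)] with [snd a > j] satisfies
    [2 w_j >= |S_j| + 2 runs(S_j) - c_j], where [c_j] counts the nonzero
    entries of row [j] which are not preceded by the opposite sign.
    Passing from one row to the next is a statement about four sequences,
    proved by scanning the columns with a finite-state potential; the only
    global input is that, by connectedness, every run of [S_j] contains a point
    of row [j] of the support.  On the lowest row of the support connectedness
    makes [S_j] an interval of [d] columns, and the nodes with
    [snd a = j] bring at least [c_j + 3] to twice the number of nodes. *)

(** * Sums and fibres *)

Fixpoint zsum (n : nat) (f : Z -> Z) : Z :=
  match n with
  | O => 0
  | S n' => zsum n' f + f (Z.of_nat n')
  end.

Lemma zsum_le (n : nat) (f g : Z -> Z) :
  (forall i, f i <= g i) -> zsum n f <= zsum n g.
Proof. intros H; induction n as [|n IH]; simpl; [lia|]. specialize (H (Z.of_nat n)); lia. Qed.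

Lemma zsum_add (n : nat) (f g : Z -> Z) :
  zsum n (fun i => f i + g i) = zsum n f + zsum n g.
Proof. induction n as [|n IH]; simpl; lia. Qed.

Lemma zsum_0 (n : nat) (f : Z -> Z) : (forall i, f i = 0) -> zsum n f = 0.
Proof. intros H; induction n as [|n IH]; simpl; [|rewrite H]; lia. Qed.

Lemma zsum_eqb (n : nat) (c : Z) : zsum n (fun i => Z.b2z (c =? i)) <= 1.
Proof.
  assert (H : zsum n (fun i => Z.b2z (c =? i)) <= Z.b2z (c <? Z.of_nat n)).
  { induction n as [|n IH]; simpl zsum.
    - destruct (c <? _); simpl; lia.
    - destruct (Z.eqb_spec c (Z.of_nat n)), (Z.ltb_spec c (Z.of_nat n)),
        (Z.ltb_spec c (Z.of_nat (S n))); simpl in *; lia. }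
  destruct (c <? _); simpl in H; lia.
Qed.

(** Each element lies in at most one fibre, and in none if its value falls outside [0..n-1]; hence
    an inequality. *)
Lemma zsum_fibres {A : Type} (g : A -> Z) (l : list A) (n : nat) :
  zsum n (fun i => Z.of_nat (length (filter (fun x => g x =? i) l)))
  <= Z.of_nat (length l).
Proof.
  induction l as [|x l IH].
  - simpl length; rewrite zsum_0; simpl; lia.
  - etransitivity.
    + apply zsum_le with (g := fun i => Z.b2z (g x =? i) +
        Z.of_nat (length (filter (fun x => g x =? i) l))).
      intros i; simpl; destruct (g x =? i); simpl length; simpl Z.b2z; lia.
    + rewrite zsum_add; pose proof (zsum_eqb n (g x)); simpl length; lia.
Qed.

Lemma zsum_grid_le (p : pt -> bool) (M : Z) (l : list pt) (n r : nat) :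
  (forall m, p m = true -> In m l) ->
  zsum r (fun t => zsum n (fun i => Z.b2z (p (i, M - t)))) <= Z.of_nat (length l).
Proof.
  intros Hl.
  etransitivity; [|apply (zsum_fibres (fun m : pt => M - snd m) l r)].
  apply zsum_le; intros t.
  etransitivity; [|apply (zsum_fibres (fun m : pt => fst m))].
  apply zsum_le; intros i.
  destruct (p (i, M - t)) eqn:Hp; simpl Z.b2z; [|lia].
  apply Hl in Hp.
  assert (Hin : In (i, M - t) (filter (fun x : pt => fst x =? i)
      (filter (fun x : pt => M - snd x =? t) l))).
  { rewrite !filter_In; simpl; repeat split; [exact Hp| |]; apply Z.eqb_eq; lia. }
  destruct (filter _ (filter _ l)); [contradiction|simpl length; lia].
Qed.

(** * Signs and nodes *)

Definition nz (x : sgn) : bool := match x with Zr => false | _ => true end.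

Definition clash (x y : sgn) : bool :=
  match x, y with Ps, Ng | Ng, Ps => true | _, _ => false end.

(** The four admissible images are exactly those that contain a sign but not both signs. *)
Definition nodeb (x y z : sgn) : bool :=
  (nz x || nz y || nz z) && negb (clash x y || clash x z || clash y z).

Definition node_at (D : pt -> sgn) (a : pt) : bool :=
  nodeb (D a) (D (fst a - 1, snd a)) (D (fst a, snd a - 1)).

Lemma nz_support (D : pt -> sgn) (m : pt) : nz (D m) = true <-> support D m.
Proof. unfold support; destruct (D m); simpl; intuition congruence. Qed.

Lemma in_image_iff (D : pt -> sgn) (a : pt) (s : sgn) :
  in_image D a s <->
  D a = s \/ D (fst a - 1, snd a) = s \/ D (fst a, snd a - 1) = s.
Proof.
  destruct a as [a1 a2]; unfold in_image, E; simpl; split.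
  - intros (x & [<-|[<-|[<-|[]]]] & H); auto.
  - intros [H|[H|H]]; eexists; (split; [|exact H]); auto.
Qed.

Lemma node_at_is_node (D : pt -> sgn) (a : pt) : node_at D a = true -> is_node D a.
Proof.
  unfold node_at, is_node; cbv zeta; rewrite !in_image_iff.
  destruct (D a), (D (fst a - 1, snd a)), (D (fst a, snd a - 1)); simpl;
    intros H; try discriminate H; intuition congruence.
Qed.

(** * The inequality between consecutive rows *)

(* [s], [a]: shadow and sign at the current column; [s'], [a']: at the previous one. *)
Definition gain (s s' : bool) (a a' : sgn) : Z :=
  Z.b2z s + 2 * Z.b2z (s && negb s') - Z.b2z (nz a && negb (clash a a')).

(** The quantity [|S_j| + 2 runs(S_j) - c_j]; a run is counted at its leftmost column. *)
Definition row_gain (n : nat) (s : Z -> bool) (a : Z -> sgn) : Z :=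
  zsum n (fun i => gain (s i) (s (i - 1)) (a i) (a (i - 1))).

(* Least total weight with which the column scan of [strip_inequality] can reach
   a state: a shortest-path distance in the finite graph of states.  [b], [s] are
   the sign and shadow in the upper row, [a], [t] those in the lower row, and [f]
   tells whether the current run of [t] has already met a nonzero [a]. *)
Definition scan_potential (a b : sgn) (s t f : bool) : Z :=
  if t then
    if nz b then if f then Z.b2z (nz a && negb (clash a b)) else 1
    else Z.b2z s - Z.b2z (negb f)
  else 0.

(** Triangle inequality for the distance along one edge of the state graph. The hypotheses single
    out the admissible edges; the last one forbids a run of [t] from ending before it has met a
    nonzero [a]. *)
Lemma scan_step (a b a' b' : sgn) (s s' t' f' : bool) :
  let t := nz a || s || s' in
  let f := t && (nz a || f') in
  (nz b = true -> s = true) -> (nz b' = true -> s' = true) ->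
  (s' = true -> t' = true) ->
  (nz a' = true -> t' = true /\ f' = true) -> (f' = true -> t' = true) ->
  (t' = true -> t = false -> f' = true) ->
  scan_potential a b s t f <=
  scan_potential a' b' s' t' f'
  + 2 * Z.b2z (nodeb b b' a) + gain s s' b b' - gain t t' a a'.
Proof.
  cbv zeta.
  destruct s', t', f', a', b'; simpl; intros Hb Hb' Hs Ha Hf Ht;
    try (specialize (Hb' eq_refl)); try (specialize (Hs eq_refl));
    try (specialize (Ha eq_refl); destruct Ha); try (specialize (Hf eq_refl));
    try discriminate;
    destruct s, b; simpl in *; try (specialize (Hb eq_refl)); try discriminate;
    destruct a; cbv in *; intuition congruence.
Qed.

Fixpoint run_met (a : Z -> sgn) (t : Z -> bool) (n : nat) : bool :=
  match n with
  | O => false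
  | S n' => t (Z.of_nat n') && (nz (a (Z.of_nat n')) || run_met a t n')
  end.

Lemma run_met_intro (a : Z -> sgn) (t : Z -> bool) (k : Z) (n : nat) :
  0 <= k < Z.of_nat n -> nz (a k) = true ->
  (forall x, k <= x < Z.of_nat n -> t x = true) -> run_met a t n = true.
Proof.
  intros Hk Ha; revert Hk; induction n as [|n IH]; intros Hk Ht; [lia|].
  simpl; rewrite Ht by lia; simpl.
  destruct (Z.eq_dec k (Z.of_nat n)) as [<-|Hne]; [now rewrite Ha|].
  rewrite IH, orb_true_r; trivial; [lia|intros; apply Ht; lia].
Qed.

Definition runs_met (a : Z -> sgn) (t : Z -> bool) : Prop :=
  forall i, t i = true ->
    exists k, nz (a k) = true /\ forall x, Z.min i k <= x <= Z.max i k -> t x = true.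

Lemma strip_inequality (a b : Z -> sgn) (s t : Z -> bool) (N : nat) :
  (forall i, t i = nz (a i) || s i || s (i - 1)) ->
  (forall i, nz (b i) = true -> s i = true) ->
  (forall i, t i = true -> 0 <= i < Z.of_nat N) ->
  runs_met a t ->
  row_gain (S N) t a <=
  row_gain (S N) s b
  + 2 * zsum (S N) (fun i => Z.b2z (nodeb (b i) (b (i - 1)) (a i))).
Proof.
  intros Ht Hb Hbd Hruns.
  assert (Hs : forall i, s i = true -> t i = true).
  { intros i H; rewrite Ht, H, orb_true_r; reflexivity. }
  assert (Ha : forall i, nz (a i) = true -> t i = true).
  { intros i H; rewrite Ht, H; reflexivity. }
  assert (Hout : forall i, ~ 0 <= i < Z.of_nat N -> t i = false).
  { intros i H; destruct (t i) eqn:E; [apply Hbd in E; lia|reflexivity]. }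
  assert (main : forall n : nat,
    let i := Z.of_nat n - 1 in
    scan_potential (a i) (b i) (s i) (t i) (run_met a t n) + row_gain n t a
    <= row_gain n s b
       + 2 * zsum n (fun i => Z.b2z (nodeb (b i) (b (i - 1)) (a i)))).
  { intros n; cbv zeta; induction n as [|n IH].
    - unfold scan_potential, row_gain; rewrite Hout by lia; simpl; lia.
    - unfold row_gain in *; simpl zsum.
      replace (Z.of_nat (S n) - 1) with (Z.of_nat n) by lia.
      set (i := Z.of_nat n) in *.
      pose proof (scan_step (a i) (b i) (a (i - 1)) (b (i - 1)) (s i) (s (i - 1))
        (t (i - 1)) (run_met a t n)) as Hstep.
      cbv zeta in Hstep; rewrite <- Ht in Hstep.
      change (run_met a t (S n)) with (t i && (nz (a i) || run_met a t n)).
      assert (Hf : run_met a t n = true -> t (i - 1) = true).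
      { unfold i; destruct n as [|n']; simpl run_met; [discriminate|].
        replace (Z.of_nat (S n') - 1) with (Z.of_nat n') by lia.
        intros H; apply andb_true_iff in H; tauto. }
      lapply Hstep; [clear Hstep; intros Hstep|apply Hb].
      lapply Hstep; [clear Hstep; intros Hstep|apply Hb].
      lapply Hstep; [clear Hstep; intros Hstep|apply Hs].
      lapply Hstep; [clear Hstep; intros Hstep|].
      2:{ intros H; split; [now apply Ha|].
          pose proof (Hbd _ (Ha _ H)).
          apply (run_met_intro a t (i - 1)); [unfold i in *; lia|exact H|].
          intros x Hx; replace x with (i - 1) by (unfold i in *; lia); now apply Ha. }
      lapply Hstep; [clear Hstep; intros Hstep|exact Hf].
      lapply Hstep; [clear Hstep; intros Hstep|].
      + lia.
      (* The run containing [i - 1] stops there, so its nonzero entry has already been scanned. *)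
      + intros H1 H0; destruct (Hruns _ H1) as (k & Hk & Hx).
        assert (k <= i - 1).
        { destruct (Z_le_gt_dec k (i - 1)); [assumption|].
          rewrite Hx in H0 by lia; discriminate. }
        pose proof (Hbd _ (Ha _ Hk)).
        apply (run_met_intro a t k); [unfold i in *; lia|exact Hk|].
        intros x Hxk; apply Hx; unfold i in *; lia. }
  (* Column [N] lies outside [t], so the potential is 0 at the end of the scan. *)
  specialize (main (S N)); cbv zeta in main.
  unfold scan_potential in main; rewrite Hout in main by lia; lia.
Qed.

(** With zeros below, the nodes are the entries counted by [c] and the zero just after each block of
    nonzero entries. Both kinds occur, so twice their number is at least [2c + 2 >= c + 3]. *)
Lemma bottom_row_nodes (b : Z -> sgn) (N : nat) :
  (forall i, nz (b i) = true -> 0 <= i < Z.of_nat N) ->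
  (exists i, nz (b i) = true) ->
  zsum (S N) (fun i => Z.b2z (nz (b i) && negb (clash (b i) (b (i - 1))))) + 3
  <= 2 * zsum (S N) (fun i => Z.b2z (nodeb (b i) (b (i - 1)) Zr)).
Proof.
  intros Hbd [k Hk].
  assert (Hout : forall i, ~ 0 <= i < Z.of_nat N -> b i = Zr).
  { intros i H; destruct (b i) eqn:E; [reflexivity| |];
      (assert (nz (b i) = true) as H' by (now rewrite E); apply Hbd in H'; lia). }
  (* The first entry of a block leaves a surplus of 1, and the node closing the block adds 2. *)
  assert (main : forall n : nat,
    zsum n (fun i => Z.b2z (nz (b i) && negb (clash (b i) (b (i - 1)))))
    + (if nz (b (Z.of_nat n - 1)) then 1
       else if k <? Z.of_nat n then 3 else 0)
    <= 2 * zsum n (fun i => Z.b2z (nodeb (b i) (b (i - 1)) Zr))).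
  { induction n as [|n IH].
    - rewrite Hout by lia; simpl; specialize (Hbd _ Hk).
      destruct (Z.ltb_spec k 0); lia.
    - simpl zsum; replace (Z.of_nat (S n) - 1) with (Z.of_nat n) by lia.
      assert (Hkn : k = Z.of_nat n -> nz (b (Z.of_nat n)) = true) by (now intros <-).
      destruct (Z.ltb_spec k (Z.of_nat n)), (Z.ltb_spec k (Z.of_nat (S n))); try lia;
        destruct (b (Z.of_nat n)), (b (Z.of_nat n - 1));
        cbn [nz clash nodeb negb andb orb Z.b2z] in *; try lia;
        assert (k = Z.of_nat n) by lia; intuition discriminate. }
  specialize (main (S N)); rewrite (Hout (Z.of_nat (S N) - 1)) in main by lia.
  specialize (Hbd _ Hk).
  destruct (Z.ltb_spec k (Z.of_nat (S N))); simpl nz in main; cbv iota in main; lia.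
Qed.

(** * Shadows *)

(* The shadow on row [M - t] of the rows [M - t, ..., M - 1]; row [M] lies above the support. *)
Fixpoint shadow (D : pt -> sgn) (M : Z) (t : nat) (i : Z) : bool :=
  match t with
  | O => false
  | S t' => nz (D (i, M - Z.of_nat t)) || shadow D M t' i || shadow D M t' (i - 1)
  end.

(** The points of row [j] reached from [m] by the steps [-e_2] and [e_1 - e_2]. *)
Definition covers (j : Z) (m : pt) (i : Z) : Prop :=
  j <= snd m /\ fst m <= i <= fst m + snd m - j.

Lemma shadow_iff (D : pt -> sgn) (M : Z) (t : nat) (i : Z) :
  (forall m, support D m -> snd m < M) ->
  shadow D M t i = true <->
  exists m, support D m /\ covers (M - Z.of_nat t) m i.
Proof.
  intros HM; unfold covers; revert i; induction t as [|t IH]; intros i.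
  - simpl; split; [discriminate|].
    intros (m & Hm & H); apply HM in Hm; lia.
  - cbn [shadow]; rewrite !orb_true_iff, !IH, nz_support; split.
    + intros [[H|(m & Hm & H)]|(m & Hm & H)].
      * exists (i, M - Z.of_nat (S t)); simpl fst; simpl snd; split; [exact H|lia].
      * exists m; split; [exact Hm|lia].
      * exists m; split; [exact Hm|lia].
    + intros (m & Hm & H).
      destruct (Z.eq_dec (snd m) (M - Z.of_nat (S t))) as [Hj|Hj].
      * left; left; replace (i, M - Z.of_nat (S t)) with m; [exact Hm|].
        destruct m as [m1 m2]; simpl in *; f_equal; lia.
      * destruct (Z.eq_dec i (fst m + snd m - (M - Z.of_nat (S t)))).
        -- right; exists m; split; [exact Hm|lia].
        -- left; right; exists m; split; [exact Hm|lia].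
Qed.

(* Until the path reaches row [j], the shadows of consecutive points overlap or
   are adjacent. *)
Lemma path_meets_row (K : pt -> Prop) (j i : Z) (m q : pt) :
  joined K m q -> covers j m i -> snd q <= j ->
  exists k, K (k, j) /\
    forall x, Z.min i k <= x <= Z.max i k -> exists m', K m' /\ covers j m' x.
Proof.
  intros Hq Hm Hqj; unfold covers in *.
  assert (main : (exists k, K (k, j) /\
      forall x, Z.min i k <= x <= Z.max i k -> exists m', K m' /\ covers j m' x) \/
    (K q /\ j <= snd q /\ forall x, covers j q x ->
      forall y, Z.min i x <= y <= Z.max i x -> exists m', K m' /\ covers j m' y)).
  { unfold covers; clear Hqj; induction Hq as [m Km|m m' m'' Hq IH Hadj Km''].
    - right; split; [exact Km|split; [lia|]].
      intros x Hx y Hy; exists m; split; [exact Km|lia].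
    - destruct (IH Hm) as [H|(Km' & Hj & H)]; [now left|].
      destruct (Z.eq_dec (snd m') j) as [Heq|Hne].
      + left; exists (fst m'); split; [rewrite <- Heq; now destruct m'|].
        apply H; lia.
      + unfold adjacent in Hadj; right; split; [exact Km''|split; [lia|]].
        intros x Hx y Hy.
        (* Each end of the base moves by at most 1 in an adjacent step, so a column outside the new
           base is handled by the nearer end of the old one. *)
        destruct (Z_lt_le_dec y (fst m'')).
        { apply (H (fst m')); lia. }
        destruct (Z_lt_le_dec (fst m'' + snd m'' - j) y).
        { apply (H (fst m' + snd m' - j)); lia. }
        exists m''; split; [exact Km''|lia]. }
  destruct main as [H|(Kq & Hj & H)]; [exact H|].
  exists (fst q); split.
  - replace (fst q, j) with q; [exact Kq|]; destruct q; simpl in *; f_equal; lia.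
  - apply H; unfold covers; lia.
Qed.

(** The right end of the base grows by at most 1 per step, so a newly reached column is the last one
    in the base of the new point. *)
Lemma path_covers_interval (K : pt -> Prop) (j : Z) (p q : pt) :
  (forall m, K m -> j <= snd m) -> joined K p q ->
  forall i, fst p <= i <= fst q + snd q - j -> exists m, K m /\ covers j m i.
Proof.
  intros Hj Hq; unfold covers; induction Hq as [m Km|m m' m'' Hq IH Hadj Km'']; intros i Hi.
  - exists m; specialize (Hj _ Km); split; [exact Km|lia].
  - destruct (Z_le_gt_dec i (fst m' + snd m' - j)); [apply IH; lia|].
    unfold adjacent in Hadj; specialize (Hj _ Km'').
    exists m''; split; [exact Km''|lia].
Qed.

Lemma interval_shadow_sum (s : Z -> bool) (l r : Z) (n : nat) :
  0 <= l <= r -> r < Z.of_nat n -> (forall i, s i = true <-> l <= i <= r) ->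
  zsum n (fun i => Z.b2z (s i) + 2 * Z.b2z (s i && negb (s (i - 1)))) = r - l + 3.
Proof.
  intros Hlr Hn Hs.
  assert (main : forall n : nat,
    zsum n (fun i => Z.b2z (s i) + 2 * Z.b2z (s i && negb (s (i - 1))))
    = if Z.of_nat n <=? l then 0 else Z.min (Z.of_nat n) (r + 1) - l + 2).
  { clear n Hn; induction n as [|n IH]; cbn [zsum].
    - destruct (Z.leb_spec (Z.of_nat 0) l); lia.
    - rewrite IH.
      pose proof (Hs (Z.of_nat n)) as H1; pose proof (Hs (Z.of_nat n - 1)) as H0.
      destruct (Z.leb_spec (Z.of_nat n) l), (Z.leb_spec (Z.of_nat (S n)) l),
        (s (Z.of_nat n)), (s (Z.of_nat n - 1)); cbn [andb negb Z.b2z]; lia. }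
  rewrite main; destruct (Z.leb_spec (Z.of_nat n) l); lia.
Qed.

(** * Summation over the rows and the final count *)

Lemma nodes_above (D : pt -> sgn) (M : Z) (N r : nat) :
  (forall m, support D m -> snd m < M) ->
  (forall t i, (t <= r)%nat -> shadow D M t i = true -> 0 <= i < Z.of_nat N) ->
  (forall t, (t <= r)%nat ->
     runs_met (fun i => D (i, M - Z.of_nat t)) (shadow D M t)) ->
  row_gain (S N) (shadow D M r) (fun i => D (i, M - Z.of_nat r))
  <= 2 * zsum r (fun t => zsum (S N) (fun i => Z.b2z (node_at D (i, M - t)))).
Proof.
  intros HM Hbd Hruns; induction r as [|r IH].
  - simpl zsum at 1; unfold row_gain; rewrite zsum_0; [lia|].
    intros i; unfold gain.
    destruct (D (i, M - Z.of_nat 0)) eqn:Hi; [reflexivity| |];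
      (assert (support D (i, M - Z.of_nat 0)) as H
         by (unfold support; rewrite Hi; discriminate);
       apply HM in H; simpl in H; lia).
  - lapply IH; [clear IH; intros IH|intros; apply (Hbd t); [lia|assumption]].
    lapply IH; [clear IH; intros IH|intros; apply Hruns; lia].
    cbn [zsum].
    (* A set [E(a)] with [a] on row [M - r] involves only that row and the next lower one, the two
       rows compared here. *)
    pose proof (strip_inequality (fun i => D (i, M - Z.of_nat (S r)))
      (fun i => D (i, M - Z.of_nat r)) (shadow D M r) (shadow D M (S r)) N) as Hstrip.
    lapply Hstrip; [clear Hstrip; intros Hstrip|reflexivity].
    lapply Hstrip; [clear Hstrip; intros Hstrip|].
    2:{ intros i Hi; apply nz_support in Hi; apply shadow_iff; [exact HM|].
        eexists; split; [exact Hi|unfold covers; simpl; lia]. }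
    lapply Hstrip; [clear Hstrip; intros Hstrip|intros i; apply Hbd; lia].
    lapply Hstrip; [clear Hstrip; intros Hstrip|apply Hruns; lia].
    unfold node_at in *; cbn [fst snd] in *.
    replace (M - Z.of_nat (S r)) with (M - Z.of_nat r - 1) in * by lia.
    cbn [zsum] in *; lia.
Qed.

Theorem mainTheorem4 (D : pt -> sgn) (d : Z) (n : nat) :
  newton_diagram2 D ->
  connected (support D) ->
  is_size (support D) d ->
  num_nodes D n ->
  2 * Z.of_nat n >= d + 5.
Proof.
  intros (_ & Hpos & _) Hcon
    (k & a1 & a2 & (q & Hq & Hqk) & Hk & (p & Hp & Hp1) & Ha1 & (w & Hw & Hw2) & Ha2 & ->)
    (l & _ & Hl & <-).
  set (M := k + 1).
  assert (HM : forall m, support D m -> snd m < M).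
  { intros m Hm; specialize (Hpos _ Hm); specialize (Hk _ Hm); unfold M; lia. }
  assert (Hpq : 0 <= a1 /\ 0 <= a2 /\ a1 + a2 <= k).
  { pose proof (Hpos _ Hp); pose proof (Hpos _ Hw); pose proof (Hk _ Hp);
      pose proof (Ha2 _ Hp); lia. }
  set (N := Z.to_nat M).
  set (r := Z.to_nat (M - a2)).
  assert (Hrow : M - Z.of_nat r = a2) by (unfold r, M; lia).
  assert (Hbd : forall t i, (t <= r)%nat -> shadow D M t i = true -> 0 <= i < Z.of_nat N).
  { intros t i Ht Hi; apply shadow_iff in Hi; [|exact HM].
    destruct Hi as (m & Hm & Hc); unfold covers in Hc.
    specialize (Hpos _ Hm); specialize (Hk _ Hm); unfold N, M in *; lia. }
  assert (Hruns : forall t, (t <= r)%nat ->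
    runs_met (fun i => D (i, M - Z.of_nat t)) (shadow D M t)).
  { intros t Ht i Hi; apply shadow_iff in Hi; [|exact HM].
    destruct Hi as (m & Hm & Hc).
    (* The point [w] on the lowest row forces the path to come down to row [M - t]. *)
    destruct (path_meets_row (support D) (M - Z.of_nat t) i m w)
      as (c & Hc1 & Hc2); [now apply Hcon|exact Hc|lia|].
    exists c; split; [now apply nz_support|].
    intros x Hx; apply shadow_iff; auto. }
  pose proof (nodes_above D M N r HM Hbd Hruns) as Habove.
  assert (Hshadow : forall i, shadow D M r i = true <-> a1 <= i <= k - a2).
  { intros i; rewrite shadow_iff by exact HM; rewrite Hrow; split.
    - intros (m & Hm & Hc); unfold covers in Hc.
      specialize (Ha1 _ Hm); specialize (Hk _ Hm); lia.
    (* The path leads from a leftmost point [p] to a point [q] on the highest diagonal, whose base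
       ends at [k - a2]. *)
    - intros Hi; apply (path_covers_interval _ _ p q); [exact Ha2|now apply Hcon|lia]. }
  pose proof (interval_shadow_sum (shadow D M r) a1 (k - a2) (S N)) as Hsum.
  lapply Hsum; [clear Hsum; intros Hsum|lia].
  lapply Hsum; [clear Hsum; intros Hsum|unfold N, M; lia].
  specialize (Hsum Hshadow).
  assert (Hbelow : forall i, D (i, a2 - 1) = Zr).
  { intros i; destruct (D (i, a2 - 1)) eqn:Hi; [reflexivity| |];
      (assert (support D (i, a2 - 1)) as H
         by (unfold support; rewrite Hi; discriminate);
       apply Ha2 in H; simpl in H; lia). }
  pose proof (bottom_row_nodes (fun i => D (i, a2)) N) as Hbot.
  lapply Hbot; [clear Hbot; intros Hbot|].
  2:{ intros i Hi; apply (Hbd r); [lia|]; apply nz_support in Hi.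
      apply shadow_iff; [exact HM|]; eexists; split; [exact Hi|].
      unfold covers; simpl; lia. }
  lapply Hbot; [clear Hbot; intros Hbot|].
  2:{ exists (fst w); apply nz_support; rewrite <- Hw2; now destruct w. }
  (* [S r] rows: the [r] rows above the lowest one, and the lowest row itself. *)
  pose proof (zsum_grid_le (node_at D) M l (S N) (S r)) as Hcount.
  lapply Hcount; [clear Hcount; intros Hcount|].
  2:{ intros m Hm; apply Hl, node_at_is_node, Hm. }
  (* The shadow sum is [d + 2]; the [c] subtracted in the gain is returned by the bottom row
     together with 3, which gives [d + 5]. *)
  assert (Hgain : zsum (S N) (fun i => Z.b2z (shadow D M r i)
        + 2 * Z.b2z (shadow D M r i && negb (shadow D M r (i - 1))))
    <= row_gain (S N) (shadow D M r) (fun i => D (i, a2))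
       + zsum (S N) (fun i => Z.b2z (nz (D (i, a2)) && negb (clash (D (i, a2)) (D (i - 1, a2)))))).
  { unfold row_gain; rewrite <- zsum_add; apply zsum_le; intros i; unfold gain; lia. }
  assert (Hbotnodes : zsum (S N) (fun i => Z.b2z (nodeb (D (i, a2)) (D (i - 1, a2)) Zr))
    <= zsum (S N) (fun i => Z.b2z (node_at D (i, M - Z.of_nat r)))).
  { apply zsum_le; intros i; unfold node_at; cbn [fst snd]; rewrite Hrow, Hbelow; lia. }
  rewrite Hrow in Habove.
  remember (S N) as N1; cbn [zsum] in Hcount; lia.
Qed.
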